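(* Let $n,k\in\mathbb{N}$ with $n\ge 3$ and $k\ge 2$, and let $MC_n^k$ be the multilayered cycle. Then the Cartesian vertex span satisfies $\sigma^{\square}_V(MC_n^k)=\left\lfloor\frac{n}{2}\right\rfloor$.
   Context: For $n\ge3$, $k\ge2$, the multilayered cycle $MC_n^k$ is the graph with vertex set $\{(i,j): i\in\mathbb{Z}_n,\ j\in\{1,\dots,k\}\}$ in which $(a,b)$ and $(c,d)$ are adjacent iff either $a=c$ and $|d-b|=1$, or $b=d$ and $a-c\equiv\pm1 \pmod n$. Write $\mathbb{N}_l=\{1,\dots,l\}$ and let $d$ denote the shortest-path distance in the graph. For a graph $G$ and $l\in\mathbb{N}$, a lazy $l$-track is a surjective map $f:\mathbb{N}_l\to V(G)$ with $f(i)f(i+1)\in E(G)$ or $f(i)=f(i+1)$ for all $i\in\mathbb{N}_{l-1}$. Two lazy $l$-tracks $f,g$ are opposite if for every $i\in\mathbb{N}_{l-1}$: $f(i)f(i+1)\in E(G)$ if and only if $g(i)=g(i+1)$. For maps $f,g:\mathbb{N}_l\to V(G)$ set $m_G(f,g)=\min\{d(f(i),g(i)): i\in\mathbb{N}_l\}$. The Cartesian vertex span $\sigma^{\square}_V(G)$ is the maximum of $m_G(f,g)$ over all $l\in\mathbb{N}$ and all pairs $f,g$ of opposite lazy $l$-tracks on $G$. *)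

(* Defs.v *)
From HB Require Import structures.
From mathcomp Require Import all_boot all_order all_algebra.

Set Implicit Arguments.
Unset Strict Implicit.
Unset Printing Implicit Defensive.

Section Span.
Variables (T : finType) (e : rel T).

Definition walk_of_length (x y : T) (d : nat) : bool :=
  [exists p : d.-tuple T, path e x p && (last x p == y)].

(* A shortest walk has at most #|T| - 1 edges, so this is the least length of
   a walk from x to y; the value is #|T| when y is not reachable from x. *)
Definition dist (x y : T) : nat := find (walk_of_length x y) (iota 0 #|T|).

(* The lengths of tracks are the positive integers, written l.+1, and the
   index set {1, ..., l.+1} is shifted to 'I_l.+1 = {0, ..., l}. *)
Definition lazy_track (l : nat) (f : 'I_l.+1 -> T) : Prop :=
  (forall v : T, exists i : 'I_l.+1, f i = v) /\
  (forall i j : 'I_l.+1, j = i.+1 :> nat -> e (f i) (f j) \/ f i = f j).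

Definition opposite (l : nat) (f g : 'I_l.+1 -> T) : Prop :=
  forall i j : 'I_l.+1, j = i.+1 :> nat -> (e (f i) (f j) <-> g i = g j).

Definition min_dist (l : nat) (f g : 'I_l.+1 -> T) : nat :=
  \big[minn/dist (f ord0) (g ord0)]_(i < l.+1) dist (f i) (g i).

Definition opposite_track_dist (m : nat) : Prop :=
  exists (l : nat) (f g : 'I_l.+1 -> T),
    [/\ lazy_track f, lazy_track g, opposite f g & min_dist f g = m].

Definition is_cartesian_vertex_span (s : nat) : Prop :=
  opposite_track_dist s /\ (forall m : nat, opposite_track_dist m -> m <= s).

End Span.

(* The layers {1, ..., k} are shifted to 'I_k = {0, ..., k - 1}. The type 'Z_n
   is the integers modulo n only for n >= 2. *)
Definition MC (n k : nat) : rel ('Z_n * 'I_k) :=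
  fun x y =>
    ((x.1 == y.1) && (`|y.2 - x.2|%N == 1))
    || ((x.2 == y.2) && ((x.1 - y.1 == 1)%R || (x.1 - y.1 == - 1)%R)).

(* Main.v *)
Require Import Defs.
From HB Require Import structures.
From mathcomp Require Import all_boot all_order all_algebra.
From mathcomp Require Import zify.

(* Upper bound: the difference of the two layers changes by at most one per
   step, and surjectivity forbids it to keep a constant sign, so at some time
   both players are on one layer, at distance at most n / 2.
   Lower bound: consider the graph of positions at distance at least n / 2
   under moves of a single player. It is symmetric, so it is enough to see
   that all antipodal positions on a common layer lie in one component. One
   player may step to a neighbouring layer, which gains one unit of distance;
   then the other may turn by one, the first follows and steps back. *)

Set Implicit Arguments.
Unset Strict Implicit.
Unset Printing Implicit Defensive.

Import GRing.Theory.

(** * Walks, distances, and opposite tracks in an arbitrary graph *)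

Section Walks.
Variables (T : finType) (e : rel T).

Lemma walk_of_lengthP (x y : T) (d : nat) :
  reflect (exists p, [/\ size p = d, path e x p & last x p = y])
          (walk_of_length e x y d).
Proof.
apply: (iffP existsP) => [[p /andP[ep /eqP <-]]|[p [sp ep lp]]].
  by exists p; rewrite size_tuple.
have sp' : size p == d by apply/eqP.
by exists (Tuple sp'); rewrite /= ep lp eqxx.
Qed.

Lemma walk_of_length0 (x : T) : walk_of_length e x x 0.
Proof. by apply/walk_of_lengthP; exists [::]. Qed.

Lemma walk_of_lengthS (x y z : T) (d : nat) :
  e x y -> walk_of_length e y z d -> walk_of_length e x z d.+1.
Proof.
move=> exy /walk_of_lengthP[p [sp ep lp]]; apply/walk_of_lengthP.
by exists (y :: p); rewrite /= sp exy.
Qed.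

Lemma dist_le (x y : T) (d : nat) :
  d < #|T| -> walk_of_length e x y d -> dist e x y <= d.
Proof.
move=> dT wd; rewrite leqNgt; apply/negP => /(before_find 0).
by rewrite nth_iota // add0n wd.
Qed.

(** The bound [m <= #|T|] covers an unreachable [y], for which [dist] takes the default value
    [#|T|]. *)
Lemma dist_ge (x y : T) (m : nat) :
  m <= #|T| -> (forall d, walk_of_length e x y d -> m <= d) -> m <= dist e x y.
Proof.
move=> mT wm; case: (boolP (has (walk_of_length e x y) (iota 0 #|T|))) => h.
  have := nth_find 0 h; rewrite nth_iota; first by rewrite add0n; apply: wm.
  by rewrite -[X in _ < X](size_iota 0) -has_find.
by rewrite /dist hasNfind // size_iota.
Qed.

Lemma min_dist_le (l : nat) (f g : 'I_l.+1 -> T) (i : 'I_l.+1) :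
  min_dist e f g <= dist e (f i) (g i).
Proof.
rewrite /min_dist; move: (mem_index_enum i).
elim: (index_enum _) => // j r IH; rewrite inE big_cons => /orP[/eqP->|/IH].
  exact: geq_minl.
by apply: leq_trans; apply: geq_minr.
Qed.

Lemma min_dist_ge (l : nat) (f g : 'I_l.+1 -> T) (m : nat) :
  (forall i, m <= dist e (f i) (g i)) -> m <= min_dist e f g.
Proof.
move=> h; apply: (big_ind (fun x => m <= x)) => // x y mx my.
by rewrite leq_min mx my.
Qed.

Definition single_move (u v : T * T) : bool :=
  (e u.1 v.1 && (u.2 == v.2)) || ((u.1 == v.1) && e u.2 v.2).

(** Imposing the distance bound at both ends keeps this relation symmetric. *)
Definition far_move (m : nat) (u v : T * T) : bool :=
  [&& single_move u v, m <= dist e u.1 u.2 & m <= dist e v.1 v.2].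

Lemma far_move_sym (m : nat) : symmetric e -> symmetric (far_move m).
Proof.
move=> esym u v; rewrite /far_move /single_move.
by rewrite (esym v.1) (esym v.2) (eq_sym v.1) (eq_sym v.2) [X in _ && X]andbC.
Qed.

End Walks.

(** Induction on [L]: by symmetry the end of the path built so far can return to [x] and go on from
    there to the next element. *)
Lemma connect_path_through (T : finType) (r : rel T) (x : T) (L : seq T) :
  connect_sym r -> {in L, forall y, connect r x y} ->
  exists2 p, path r x p & {subset L <= x :: p}.
Proof.
move=> rsym; elim: L => [|y L IH] cL; first by exists [::].
have [|p rp Lp] := IH; first by move=> z zL; apply: cL; rewrite inE zL orbT.
have cxp : connect r x (last x p) by apply/connectP; exists p.
have : connect r (last x p) y.
  by apply: (@connect_trans _ _ x); [rewrite rsym | apply: cL; rewrite mem_head].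
case/connectP=> q rq yq; exists (p ++ q); first by rewrite cat_path rp.
move=> z; rewrite inE -cat_cons mem_cat => /predU1P[->|/Lp-> //].
case: q yq {rq} => [|a q] -> /=; first by rewrite mem_last.
by rewrite mem_last orbT.
Qed.

(** A path of [far_move] through the whole component of [x] projects to two tracks. Each step moves
    exactly one player, as [e] is irreflexive, so the tracks are opposite. *)
Lemma opposite_tracks_of_connect (T : finType) (e : rel T) (m : nat) (x : T * T) :
  irreflexive e -> symmetric e -> m <= dist e x.1 x.2 ->
  (forall v, exists w, connect (far_move e m) x (v, w)) ->
  (forall w, exists v, connect (far_move e m) x (v, w)) ->
  exists (l : nat) (f g : 'I_l.+1 -> T),
    [/\ lazy_track e f, lazy_track e g, opposite e f g & m <= min_dist e f g].
Proof.
move=> eirr esym mx c1 c2.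
have rsym : connect_sym (far_move e m).
  by apply: sym_connect_sym; apply: far_move_sym.
have [|p rp Lp] := @connect_path_through _ _ x
  [seq y <- enum {: T * T} | connect (far_move e m) x y] rsym.
  by move=> y; rewrite mem_filter => /andP[].
have cov y : connect (far_move e m) x y ->
    exists i : 'I_(size p).+1, nth x (x :: p) i = y.
  move=> cy; have /Lp yp : y \in [seq y <- enum {: T * T} | connect (far_move e m) x y].
    by rewrite mem_filter cy mem_enum.
  have ip : index y (x :: p) < (size p).+1 by rewrite -[(size p).+1]/(size (x :: p)) index_mem.
  by exists (Ordinal ip); rewrite nth_index.
have move_at (i j : 'I_(size p).+1) : j = i.+1 :> nat ->
    far_move e m (nth x (x :: p) i) (nth x (x :: p) j).
  move=> ji; have ip : i < size p by rewrite -ltnS -ji.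
  by rewrite ji; apply: (pathP x rp).
exists (size p), (fun i => (nth x (x :: p) i).1), (fun i => (nth x (x :: p) i).2).
split.
- split=> [v|i j /move_at].
    by have [w /cov[i iE]] := c1 v; exists i; rewrite iE.
  by case/and3P=> /orP[/andP[]|/andP[/eqP]]; [left | right].
- split=> [w|i j /move_at].
    by have [v /cov[i iE]] := c2 w; exists i; rewrite iE.
  by case/and3P=> /orP[/andP[_ /eqP]|/andP[]]; [right | left].
- move=> i j /move_at /and3P[/orP[/andP[ef /eqP eg]|/andP[/eqP ef eg]] _ _] //.
  by rewrite ef eirr; split=> // gE; move: eg; rewrite gE eirr.
- apply: min_dist_ge => -[[|i] ip] //=.
  by have /(pathP x)/(_ i ip)/and3P[] := rp.
Qed.

(** A discrete intermediate value argument: [G - F] drops by at most one per step, so it cannot turn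
    negative without vanishing first. *)
Lemma stays_below (l : nat) (F G : 'I_l.+1 -> nat) :
  (forall i, F i <> G i) ->
  (forall i j : 'I_l.+1, j = i.+1 :> nat -> F j + G i <= F i + G j + 1) ->
  F ord0 < G ord0 -> forall i, F i < G i.
Proof.
move=> FG step FG0 [i il]; elim: i il => [|i IH] il.
  by rewrite (_ : Ordinal il = ord0) //; apply: val_inj.
have il' : i < l.+1 by apply: ltnW.
have := step (Ordinal il') (Ordinal il) erefl.
have := FG (Ordinal il); have := IH il'; lia.
Qed.

(** * Distances in the multilayered cycle *)

Section MultilayeredCycle.
Variables (p k : nat).
(** In this form ['Z_n] is convertible to ['I_n]. *)
Local Notation n := p.+3.
Local Notation V := ('Z_n * 'I_k)%type.
Local Notation e := (@MC n k).

Definition cycle_norm (z : 'Z_n) : nat := minn z (n - z).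

Lemma val_Zp_succ (z : 'Z_n) :
  nat_of_ord (z + 1)%R = if z.+1 == n then 0 else z.+1.
Proof.
have zn : z < n := ltn_ord z.
rewrite [LHS]/= (@modn_small 1) // addn1.
case: (z.+1 =P n) => [->|zN]; first exact: modnn.
by apply: modn_small; change (z.+1 < n); lia.
Qed.

Lemma cycle_norm_succ (z : 'Z_n) :
  cycle_norm (z + 1)%R <= (cycle_norm z).+1 /\
  cycle_norm z <= (cycle_norm (z + 1)%R).+1.
Proof.
have zn : z < n := ltn_ord z.
by rewrite /cycle_norm val_Zp_succ; case: eqP => h; split; lia.
Qed.

Lemma MC_sym : symmetric e.
Proof.
move=> x y; rewrite /MC [y.1 == _]eq_sym [y.2 == _]eq_sym distnC.
by rewrite -(opprB x.1 y.1) (eqr_oppLR _ 1%R) eqr_opp [(_ == - 1)%R || _]orbC.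
Qed.

Lemma MC_irr : irreflexive e.
Proof.
by move=> x; rewrite /MC !eqxx distnn subrr !(eq_sym 0%R) oppr_eq0 oner_eq0.
Qed.

(** The sum of the distances in the cycle and in the path of layers; it drops by at most one along
    an edge, hence bounds walk lengths from below. *)
Definition MC_lower (x y : V) : nat :=
  cycle_norm (y.1 - x.1)%R + `|y.2 - x.2|%N.

Lemma MC_lower_step (x y z : V) : e x y -> MC_lower x z <= (MC_lower y z).+1.
Proof.
case/orP=> [/andP[/eqP xy1]|/andP[/eqP xy2 xy1]]; rewrite /MC_lower.
  by rewrite xy1; lia.
rewrite xy2 -addSn leq_add2r; case/orP: xy1 => /eqP xy1.
  have -> : (z.1 - y.1 = z.1 - x.1 + 1)%R by rewrite -xy1 addrA subrK.
  by case: (cycle_norm_succ (z.1 - x.1)%R).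
have -> : (z.1 - x.1 = z.1 - y.1 + 1)%R.
  by rewrite -[1%R]opprK -xy1 opprB addrA subrK.
by case: (cycle_norm_succ (z.1 - y.1)%R).
Qed.

Lemma MC_lower_le (x y : V) (d : nat) : walk_of_length e x y d -> MC_lower x y <= d.
Proof.
case/walk_of_lengthP=> s [<- es <-] {d y}.
elim: s x es => [|y s IH] x /=; first by rewrite /MC_lower subrr distnn.
by case/andP=> /(MC_lower_step (last y s)) h /IH le; apply: leq_trans h _.
Qed.

Lemma MC_rotate (s : 'Z_n) (d : nat) (a : 'Z_n) (b : 'I_k) :
  s = 1%R \/ s = (- 1)%R -> walk_of_length e (a, b) (a + s *+ d, b)%R d.
Proof.
move=> s1; elim: d a => [|d IH] a; first by rewrite addr0; apply: walk_of_length0.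
apply: (walk_of_lengthS (y := (a + s, b)%R)); last by rewrite mulrS addrA; apply: IH.
apply/orP; right; rewrite /= eqxx opprD addNKr.
by case: s1 => ->; rewrite ?opprK ?eqxx ?orbT.
Qed.

Lemma card_MC : #|{: V}| = n * k.
Proof. by rewrite card_prod !card_ord. Qed.

(** Rotate along the shorter arc: [z] steps by 1, or [n - z] steps by -1. *)
Lemma dist_same_layer (x y : V) : x.2 = y.2 -> dist e x y <= n %/ 2.
Proof.
case: x y => [a b] [c b'] /= <- {b'}; have bk := ltn_ord b.
have cardV : n %/ 2 < #|{: V}| by rewrite card_MC; nia.
pose z := (c - a)%R; have zn : z < n := ltn_ord z.
have zE : (1 *+ z = z :> 'Z_n)%R by rewrite -[RHS]natr_Zp.
have [zh|zh] := leqP z (n %/ 2).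
  apply: leq_trans (zh); apply: dist_le; first exact: leq_ltn_trans zh cardV.
  rewrite (_ : c = a + 1 *+ z)%R; first by apply: MC_rotate; left.
  by rewrite zE addrC subrK.
have nzh : n - z <= n %/ 2 by lia.
apply: leq_trans (nzh); apply: dist_le; first exact: leq_ltn_trans nzh cardV.
rewrite (_ : c = a + (- 1) *+ (n - z))%R; first by apply: MC_rotate; right.
rewrite mulNrn mulrnBr ?(ltnW zn) // zE.
have -> : (1 *+ n = 0 :> 'Z_n)%R by apply: (pchar_Zp (p := n)).
by rewrite sub0r opprK addrC subrK.
Qed.

(** * Upper bound *)

Hypothesis k_gt1 : 1 < k.

Lemma min_dist_opposite_le (l : nat) (f g : 'I_l.+1 -> V) :
  lazy_track e f -> lazy_track e g -> opposite e f g ->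
  min_dist e f g <= n %/ 2.
Proof.
move=> [fsurj fstep] [gsurj gstep] fg.
have [/existsP[i /eqP fgi]|/existsPn noti] := boolP [exists i, (f i).2 == (g i).2].
  exact: leq_trans (min_dist_le _ _ _ i) (dist_same_layer fgi).
have FG i : nat_of_ord (f i).2 <> (g i).2 by move/val_inj/eqP; apply/negP.
have MC_layer (x y : V) : e x y -> x.2 <= y.2 + 1 /\ y.2 <= x.2 + 1.
  by case/orP=> /andP[/eqP h]; rewrite ?h; split; lia.
(* While [f] moves, [g] stands still, so the layer difference changes by at most one and not by
   two. *)
have step (i j : 'I_l.+1) : j = i.+1 :> nat ->
    (f j).2 + (g i).2 <= (f i).2 + (g j).2 + 1 /\
    (g j).2 + (f i).2 <= (g i).2 + (f j).2 + 1.
  move=> ij; case: (fstep i j ij) => [efij|fij].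
    by move: (efij) => /(fg i j ij)->; case: (MC_layer _ _ efij); split; lia.
  rewrite fij; case: (gstep i j ij) => [/MC_layer[]|->]; split; lia.
(* The player who stays strictly lower visits the top layer at some time, and then the other has no
   layer left above. *)
have kk : k.-1 < k by lia.
pose top : V := (0%R, Ordinal kk).
case: (ltngtP (f ord0).2 (g ord0).2) => [fg0|fg0|/FG//].
  have [i fi] := fsurj top.
  have := @stays_below l (fun i => (f i).2) (fun i => (g i).2) FG
    (fun i j ij => proj1 (step i j ij)) fg0 i.
  by rewrite fi /=; have := ltn_ord (g i).2; lia.
have [i gi] := gsurj top.
have := @stays_below l (fun i => (g i).2) (fun i => (f i).2) (fun i h => FG i (esym h))
  (fun i j ij => proj2 (step i j ij)) fg0 i.
by rewrite gi /=; have := ltn_ord (f i).2; lia.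
Qed.

(** * Lower bound *)

Local Notation far := (far_move e (n %/ 2)).
Local Notation half := ((n %/ 2)%:R : 'Z_n)%R.

Lemma dist_ge_half (x y : V) : n %/ 2 <= MC_lower x y -> n %/ 2 <= dist e x y.
Proof.
move=> h; apply: dist_ge => [|d /MC_lower_le]; last exact: leq_trans.
by rewrite card_MC; nia.
Qed.

Lemma val_half : half = n %/ 2 :> nat.
Proof. by rewrite val_Zp_nat // modn_small //; lia. Qed.

Lemma dist_antipodal (a : 'Z_n) (i j : 'I_k) :
  n %/ 2 <= dist e (a, i) (a + half, j)%R.
Proof.
apply: dist_ge_half; rewrite /MC_lower [(_, _).1]/= (addrC a) addrK.
by rewrite /cycle_norm val_half; lia.
Qed.

(** One turn past [half] costs at most one unit of cycle distance, which the difference of layers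
    pays back. *)
Lemma dist_near_antipodal (a : 'Z_n) (i j : 'I_k) :
  i != j -> n %/ 2 <= dist e (a, i) (a + half + 1, j)%R.
Proof.
move=> ij; have {}ij : i != j :> nat by [].
apply: dist_ge_half; rewrite /MC_lower [(_, _).1]/= -(addrA a half) (addrC a) addrK.
rewrite /cycle_norm val_Zp_succ val_half [(_, j).2]/= [(_, i).2]/=.
by case: eqP; lia.
Qed.

Definition antipodal (a : 'Z_n) (j : 'I_k) : V * V := ((a, j), (a + half, j))%R.

Lemma MC_vertical (a : 'Z_n) (i j : 'I_k) : `|j - i|%N = 1 -> e (a, i) (a, j).
Proof. by move=> ij; rewrite /MC /= eqxx ij. Qed.

Lemma MC_horizontal (a : 'Z_n) (j : 'I_k) : e (a, j) (a + 1, j)%R.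
Proof. by rewrite /MC /= eqxx opprD addNKr eqxx !orbT. Qed.

(** The players change layer one after the other; in between they are still antipodal in the cycle,
    hence far apart. *)
Lemma antipodal_layer (a : 'Z_n) (i j : 'I_k) :
  `|j - i|%N = 1 -> connect far (antipodal a i) (antipodal a j).
Proof.
move=> ij; apply: (@connect_trans _ _ ((a, j), (a + half, i))%R); apply: connect1.
  by rewrite /far_move /single_move !dist_antipodal /= (MC_vertical _ ij) eqxx.
by rewrite /far_move /single_move !dist_antipodal /= (MC_vertical _ ij) eqxx orbT.
Qed.

Lemma antipodal_rotate (a : 'Z_n) (j : 'I_k) :
  connect far (antipodal a j) (antipodal (a + 1)%R j).
Proof.
(* A neighbouring layer exists because [k > 1]: take 1 if [j] is 0, and [j - 1] otherwise. *)
have [j' jj'] : exists j' : 'I_k, `|j' - j|%N = 1.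
  have jk := ltn_ord j; have [j0|j0] := posnP j.
    by exists (Ordinal k_gt1) => /=; rewrite j0.
  have jk' : j.-1 < k by lia.
  by exists (Ordinal jk') => /=; lia.
have j'j : `|j - j'|%N = 1 by rewrite distnC.
have neq : j' != j by apply/eqP => h; move: jj'; rewrite h distnn.
have aE : (a + half + 1 = a + 1 + half)%R by rewrite addrAC.
apply: (@connect_trans _ _ ((a, j'), (a + half, j))%R).
  apply: connect1.
  by rewrite /far_move /single_move !dist_antipodal /= (MC_vertical _ jj') eqxx.
(* This is the only position on the way that is not antipodal in the cycle; it is far because the
   layers [j'] and [j] differ. *)
apply: (@connect_trans _ _ ((a, j'), (a + half + 1, j))%R).
  apply: connect1; rewrite /far_move /single_move dist_antipodal.
  by rewrite dist_near_antipodal //= MC_horizontal eqxx orbT.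
apply: (@connect_trans _ _ ((a + 1, j'), (a + 1 + half, j))%R).
  apply: connect1; rewrite /far_move /single_move dist_antipodal.
  by rewrite dist_near_antipodal //= MC_horizontal aE eqxx.
apply: connect1; rewrite /far_move /single_move !dist_antipodal /=.
by rewrite (MC_vertical _ j'j) eqxx.
Qed.

Lemma connect_antipodal (a i : 'Z_n) (b j : 'I_k) :
  connect far (antipodal a b) (antipodal i j).
Proof.
have csym : connect_sym far.
  by apply: sym_connect_sym; apply: far_move_sym; apply: MC_sym.
have k_gt0 : 0 < k by lia.
have down c : forall m (mk : m < k),
    connect far (antipodal c (Ordinal k_gt0)) (antipodal c (Ordinal mk)).
  elim=> [|m IH] mk.
    by rewrite (_ : Ordinal mk = Ordinal k_gt0) //; apply: val_inj.
  apply: connect_trans (IH (ltnW mk)) _; apply: antipodal_layer => /=; lia.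
have rot m : connect far (antipodal 0%R j) (antipodal m%:R%R j).
  elim: m => [|m IH]; first exact: connect0.
  by apply: connect_trans IH _; rewrite -natr1; apply: antipodal_rotate.
have rotZ c : connect far (antipodal 0%R j) (antipodal c j).
  by rewrite -[c]natr_Zp.
(* Route: from layer [b] to layer 0 and on to layer [j], then back from angle [a] to 0 and on to
   [i]. *)
apply: (@connect_trans _ _ (antipodal a j)).
  apply: (@connect_trans _ _ (antipodal a (Ordinal k_gt0))).
    by rewrite csym; case: b => b bk; apply: down.
  by case: (j) => j' jk; apply: down.
by apply: (@connect_trans _ _ (antipodal 0%R j)); rewrite // csym.
Qed.

Lemma MC_cartesian_vertex_span : is_cartesian_vertex_span e (n %/ 2).
Proof.
split=> [|m [l [f [g [lf lg fg <-]]]]]; last exact: min_dist_opposite_le.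
have k_gt0 : 0 < k by lia.
have [|v|w|l [f [g [lf lg fg le]]]] := opposite_tracks_of_connect
  (x := antipodal 0%R (Ordinal k_gt0)) (m := n %/ 2) MC_irr MC_sym.
- exact: dist_antipodal.
- exists (v.1 + half, v.2)%R; case: v => i j; exact: connect_antipodal.
- exists (w.1 - half, w.2)%R; case: w => i j /=.
  have := connect_antipodal 0%R (i - half)%R (Ordinal k_gt0) j.
  by rewrite /antipodal subrK.
(* The tracks only guarantee at least [n %/ 2]; the upper bound turns this into equality. *)
exists l, f, g; split=> //; apply/eqP; rewrite eqn_leq le andbT.
exact: min_dist_opposite_le.
Qed.

End MultilayeredCycle.

Theorem theorem1 (n k : nat) (hn : 3 <= n) (hk : 2 <= k) :
  is_cartesian_vertex_span (@MC n k) (n %/ 2).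
Proof.
case: n hn => [|[|[|p]]] // _; exact: MC_cartesian_vertex_span.
Qed.
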